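(* Let $G$ be a commutative cancellative semigroup of cardinality $\kappa$, and let $\theta\le\kappa$. If $\circledast^*(\kappa,\theta,\omega)$ holds, then $G\nrightarrow[\kappa]^{\mathrm{SuS}}_\theta$ holds.
   Context: $\circledast^*(\kappa,\theta,\omega)$ asserts there is $d:[\kappa]^{<\omega}\rightarrow\theta$ (where $[\kappa]^{<\omega}$ is the set of finite subsets of $\kappa$) such that for every integer $n\ge2$, every sequence $\langle\mathcal X_i\mid i<n\rangle$ of subfamilies of $[\kappa]^{<\omega}$ each of size $\kappa$, and every $\delta<\theta$, there is $\langle x_i\mid i<n\rangle$ with $x_i\in\mathcal X_i$, $\langle\sup(x_i)\mid i<n\rangle$ strictly increasing, and $d(z)=\delta$ whenever $\bigcup_{i<n}\big(x_i\setminus\bigcup_{j\ne i}x_j\big)\subseteq z\subseteq\bigcup_{i<n}x_i$. $G\nrightarrow[\lambda]^{\mathrm{SuS}}_\theta$ means there is a colouring $c:G\rightarrow\theta$ such that for every integer $m\ge2$ and all $X_1,\ldots,X_m\subseteq G$ each of cardinality $\lambda$, $c[X_1+\cdots+X_m]=\theta$, where $X_1+\cdots+X_m=\{x_1+\cdots+x_m\mid x_i\in X_i\}$. *)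

(* Defs.v *)
From mathcomp Require Import all_boot all_order.
From mathcomp Require Import finmap.
From mathcomp Require Import boolp classical_sets functions cardinality.
From mathcomp Require wochoice.
Set Implicit Arguments.
Unset Strict Implicit.
Unset Printing Implicit Defensive.

Local Open Scope classical_set_scope.
Local Open Scope card_scope.

(* A von Neumann cardinal: an initial ordinal, i.e. a well-ordered type none of
   whose proper initial segments has the cardinality of the whole.  The elements
   of the type are the ordinals below the cardinal.  Finite cardinals are
   included. *)
Record cardinal := Cardinal {
  cdisp : Order.disp_t;
  csort :> orderType cdisp;
  cardinal_wo : wochoice.well_order (<=%O : rel csort);
  cardinal_init : forall a : csort, ~ ([set: csort] #<= [set b : csort | (b < a)%O])
}.

(* The subsets x of kappa being finite, sup x is an element of kappa;
   [supremums [set` x]] is {sup x}, and {0} when x is empty. *)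
Definition circledast_star (kappa theta : cardinal) : Prop :=
  exists d : {fset kappa} -> theta,
  forall (n : nat) (X : 'I_n -> set {fset kappa}) (delta : theta),
    (2 <= n)%N -> (forall i, X i #= [set: kappa]) ->
    exists x : 'I_n -> {fset kappa},
      [/\ forall i, X i (x i),
          exists s : 'I_n -> kappa,
            (forall i, supremums [set` x i] (s i)) /\
            (forall i j : 'I_n, (i < j)%N -> (s i < s j)%O)
        & forall z : {fset kappa},
            (\bigcup_(i in 'I_n) (x i `\` \bigcup_(j | j != i) x j) `<=` z)%fset ->
            (z `<=` \bigcup_(i in 'I_n) x i)%fset ->
            d z = delta].

Definition cancellative (G : addSemigroupType) : Prop :=
  forall a b c : G, (a + b = a + c)%R -> b = c.

(* x_0 + ... + x_m; a semigroup need not have a neutral element, so the sum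
   starts from x_0. *)
Definition sgsum (G : addSemigroupType) (m : nat) (x : 'I_m.+1 -> G) : G :=
  foldl +%R%R (x ord0) [seq x (lift ord0 i) | i <- enum 'I_m].

Definition sumset (G : addSemigroupType) (m : nat) (X : 'I_m.+1 -> set G) :
    set G :=
  [set sgsum x | x in [set x : 'I_m.+1 -> G | forall i, X i (x i)]].

(* G -/-> [lambda]^SuS_theta; the number m.+2 of summands ranges over the
   integers >= 2. *)
Definition SuS_negative (G : addSemigroupType) (lambda theta : cardinal) : Prop :=
  exists c : G -> theta,
  forall (m : nat) (X : 'I_m.+2 -> set G),
    (forall i, X i #= [set: lambda]) ->
    c @` sumset X = [set: theta].

(* Main.v *)
(* The heart of the matter is to find, for a commutative cancellative semigroup
   [G], characters [phi_a : G -> C^*] indexed by [a : G] that jointly separate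
   points and such that every [x] has a finite support {a | phi_a x <> 1}.  They
   come from Zorn's lemma on the Grothendieck group of [G]: a partial family is
   extended to a new element [a] by taking roots in the divisible group C^* of
   the values already prescribed, and injectivity is kept by activating the
   fresh coordinate [a], at which the earlier elements take the value 1.  Taking
   for C the algebraic numbers, which are countable, each finite set is the
   support of countably many elements only.  The support of a sum contains every
   point lying in exactly one of the supports of the summands, and is contained
   in their union, so if [d] witnesses the star principle then [d] composed with
   the support is the required colouring, provided taking supports preserves the
   cardinality of sets of size [kappa].  This is the case when [kappa] is
   uncountable.  When [kappa] is countable, the principle forces [kappa] to be
   infinite and, by the pigeonhole principle on initial segments, [theta] to
   have a single element. *)
From HB Require Import structures.
Require Import Defs.
From mathcomp Require Import all_boot all_order all_algebra all_field.
From mathcomp Require Import finmap.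
From mathcomp Require Import boolp classical_sets functions cardinality.
Set Implicit Arguments.
Unset Strict Implicit.
Unset Printing Implicit Defensive.
Import Order.TTheory GRing.Theory Num.Theory.
Local Open Scope classical_set_scope.
Local Open Scope card_scope.

(** * Cardinality *)

Lemma inj_card_leP T U (A : set T) (B : set U) (u0 : U) :
  A #<= B <-> exists2 f : T -> U, set_fun A B f & set_inj A f.
Proof.
split=> [|/injfunPex[f]]; last exact: inj_card_le f.
elim/Ppointed: U => U in B u0 *; first by case: (no u0).
by move=> /pcard_leP/injfunPex.
Qed.

(* [R] is the graph of an injection of D * nat into D, for some subset D of [A]. *)
Record partial_absorption T (A : set T) (R : set (T * nat * T)) : Prop :=
  PartialAbsorption {
  pabs_sub : forall p b, R (p, b) -> A p.1;
  pabs_fun : forall p b c, R (p, b) -> R (p, c) -> b = c;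
  pabs_inj : forall p q b, R (p, b) -> R (q, b) -> p = q;
  pabs_total : forall p b n, R (p, b) -> exists c, R ((p.1, n), c);
  pabs_range : forall p b n, R (p, b) -> exists c, R ((b, n), c) }.

Lemma pabs_bigcup T (A : set T) (F : set (set (T * nat * T))) :
  F `<=` partial_absorption A -> total_on F subset ->
  partial_absorption A (\bigcup_(R in F) R).
Proof.
move=> FP Ft; split.
- by move=> p b [R FR]; exact: pabs_sub (FP _ FR) _ _.
- move=> p b c [R FR Rb] [S FS Sc]; have [RS|SR] := Ft _ _ FR FS.
    exact (pabs_fun (FP _ FS) (RS _ Rb) Sc).
  exact (pabs_fun (FP _ FR) Rb (SR _ Sc)).
- move=> p q b [R FR Rb] [S FS Sc]; have [RS|SR] := Ft _ _ FR FS.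
    exact (pabs_inj (FP _ FS) (RS _ Rb) Sc).
  exact (pabs_inj (FP _ FR) Rb (SR _ Sc)).
- move=> p b n [R FR Rb]; have [c Rc] := pabs_total (FP _ FR) n Rb.
  by exists c, R.
- move=> p b n [R FR Rb]; have [c Rc] := pabs_range (FP _ FR) n Rb.
  by exists c, R.
Qed.

(** The range of a sequence absorbs its own product with [nat] through the pairing [pickle]. As the
    sequence avoids the domain of [R], the two graphs do not interfere. *)
Lemma pabs_extend T (A : set T) R (s : nat -> T) : partial_absorption A R ->
  injective s -> (forall n, A (s n)) -> (forall n m c, ~ R ((s n, m), c)) ->
  partial_absorption A
    (R `|` range (fun ij : nat * nat =>
                    ((s ij.1, ij.2), s (choice.pickle ij)))).
Proof.
move=> PR sI As sR.
(* Values of [R] belong to its domain, so a fresh point is not a value either. *)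
have sR' p n : ~ R (p, s n) by move=> /(pabs_range PR 0)[c]; exact: sR.
split.
- by move=> p b [/(pabs_sub PR)//|[[i j] _ [<- _]]]; exact: As.
- move=> p b c [Rb|[[i j] _ [<- <-]]] [Rc|[[k l] _ []]].
  + exact (pabs_fun PR Rb Rc).
  + by move=> pE; move: Rb; rewrite -pE => /sR.
  + by have := sR _ _ _ Rc.
  + by move=> /sI -> -> ->.
- move=> p q b [Rp|[[i j] _ [<- <-]]] [Rq|[[k l] _ []]].
  + exact (pabs_inj PR Rp Rq).
  + by move=> _ bE; move: Rp; rewrite -bE => /sR'.
  + by have := sR' _ _ Rq.
  + by move=> <- /sI /(pcan_inj choice.pickleK) [-> ->].
- move=> p b n [/(pabs_total PR n)[c Rc]|[[i j] _ [<- _]]].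
    by exists c; left.
  by exists (s (choice.pickle (i, n))); right; exists (i, n).
- move=> p b n [/(pabs_range PR n)[c Rc]|[ij _ [_ <-]]].
    by exists c; left.
  exists (s (choice.pickle (choice.pickle ij, n))); right.
  by exists (choice.pickle ij, n).
Qed.

(** By Zorn's lemma some absorption [R] is maximal. Its domain [A0] misses only finitely many points
    of [A], since otherwise a sequence of missed points would extend it; the missed points are then
    fitted into a single row of [A0 * nat]. *)
Lemma infinite_card_le_Xnat T (A : set T) :
  infinite_set A -> A `*` [set: nat] #<= A.
Proof.
move=> Ainf; have [R [PR Rmax]] := Zorn_bigcup (@pabs_bigcup T A).
pose A0 := [set a | exists c, R ((a, 0), c)].
have A0P p c : R (p, c) -> A0 p.1 by move=> /(pabs_total PR 0).
have A0A : A0 `<=` A by move=> a [c /(pabs_sub PR)].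
have A0fin : finite_set (A `\` A0).
  apply: contrapT => /infiniteP.
  have [t0 _] := infinite_setN0 Ainf; move=> /(inj_card_leP _ _ t0)[s sA sI].
  have {}sI : injective s by move=> i j; apply: sI; rewrite inE.
  have sR n m c : ~ R ((s n, m), c).
    by move=> /A0P; have [] := sA n I.
  apply: Rmax (pabs_extend PR sI (fun n => (sA n I).1) sR); split.
    exact: subsetUl.
  move=> /(_ ((s 0, 0), s (choice.pickle (0, 0)))) SR.
  apply: (sR 0 0 (s (choice.pickle (0, 0)))).
  by apply: SR; right; exists (0, 0).
have [a0 A0a0] : A0 !=set0.
  apply/set0P/negP => /eqP A0e; apply: Ainf; move: A0fin.
  by rewrite A0e setD0.
have /countable_injP[g gI] := finite_set_countable A0fin.
have [F FR] : exists F : T * nat -> T, forall a n, A0 a -> R ((a, n), F (a, n)).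
  have /choice[F FP] : forall p : T * nat, exists c, A0 p.1 -> R (p, c).
    move=> [a n]; have [[b Rb]|//] := pselect (A0 a).
      by have [c Rc] := pabs_total PR n Rb; exists c.
    by move=> Na; exists a.
  by exists F => a n; exact: FP (a, n).
(* The successor keeps the images of the missed points apart from [(a0, 0)], the image of [a0]. *)
pose e a := if `[< A0 a >] then (a, 0) else (a0, (g a).+1).
have eA a : A0 (e a).1 by rewrite /e; case: asboolP.
have eI : {in A &, injective e}.
  move=> a b; rewrite !inE /e => Aa Ab.
  case: asboolP => [_|Na]; case: asboolP => [_|Nb] //.
    by case.
  by case=> /gI; apply; rewrite inE.
(* The injection is the composite of A * nat -> A0 * nat * nat -> A0 * nat -> A0, given by [e],
   [pickle] and [F]. *)
apply/(inj_card_leP _ _ a0); exists (fun p : T * nat =>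
  F ((e p.1).1, choice.pickle ((e p.1).2, p.2))).
  move=> [a n] _ /=; apply: A0A.
  exact (pabs_range PR 0 (FR _ (choice.pickle ((e a).2, n)) (eA a))).
move=> [a n] [b m]; rewrite !inE => -[/= Aa _] [/= Ab _] Fab.
have Ra := FR _ (choice.pickle ((e a).2, n)) (eA a).
have Rb := FR _ (choice.pickle ((e b).2, m)) (eA b).
rewrite -Fab in Rb.
have [ab1 /(pcan_inj choice.pickleK)[ab2 ->]] := pabs_inj PR Ra Rb.
congr (_, _); apply: eI; rewrite ?inE //.
by rewrite (surjective_pairing (e a)) (surjective_pairing (e b)) ab1 ab2.
Qed.

(** The map [(f, code)] embeds [A] into the product of its image with [nat]. The image is infinite,
    as [A] would otherwise be countable, so it absorbs the factor [nat]. *)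
Lemma card_image_countable_fibres T U V (A : set T) (K : set V)
    (f : T -> U) (code : T -> nat) :
  injective (fun x => (f x, code x)) -> ~ countable K -> A #= K -> f @` A #= K.
Proof.
move=> fI Kunc AK; have /card_eqPle[AleK KleA] := AK.
have [x0 Ax0] : A !=set0.
  apply/set0P/negP => /eqP A0; apply: Kunc; apply: (card_le_trans KleA).
  by rewrite A0; exact: card_ge0.
have AX : A #<= (f @` A) `*` [set: nat].
  apply/(inj_card_leP _ _ (f x0, 0)); exists (fun x => (f x, code x)).
    by move=> x Ax; split=> //; exists x.
  by move=> x y _ _ /fI.
apply/card_eqPle; split; first exact: card_le_trans (card_image_le _ _) AleK.
apply: (card_le_trans KleA); apply: (card_le_trans AX).
apply: infinite_card_le_Xnat => Afin; apply: Kunc.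
apply: (card_le_trans KleA); apply: (card_le_trans AX).
by apply: countableX => //; exact: finite_set_countable.
Qed.

(** * The star principle for countable cardinals *)

Lemma circledast_star_infinite (kappa theta : cardinal) :
  circledast_star kappa theta -> infinite_set [set: kappa].
Proof.
move=> [d dP] [n kn].
(* If [kappa] had [n] elements, the family of singletons, repeated [n.+2] times, would yield [n.+2]
   distinct suprema. The colour [d fset0] is an arbitrary choice. *)
have [x [_ [s [_ smono]] _]] :=
  dP n.+2 (fun=> [set [fset a]%fset | a in [set: kappa]]) (d fset0) isT
    (fun i => inj_card_eq (fun a b _ _ => @fset1_inj _ a b)).
have sI : injective s.
  move=> i j sij; apply/val_inj/eqP; case: ltngtP => // /smono;
  by rewrite sij ltxx.
have /card_eqPle[kn' _] := kn; have /card_eqPle[IIn _] := @card_II n.+2.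
have : `I_n.+2 #<= `I_n.
  apply: (card_le_trans IIn); apply: (fun h => card_le_trans h kn').
  by apply/(inj_card_leP _ _ (s ord0)); exists s => // i j _ _ /sI.
by rewrite card_le_II ltnNge leqnSn.
Qed.

(** Infinitely many initial segments always include one of each prescribed colour. For a given
    colour, either the segments of that colour or the remaining ones are infinite in number, which
    leaves no room for a second colour. *)
Lemma circledast_star_countable (kappa theta : cardinal) :
  countable [set: kappa] -> circledast_star kappa theta ->
  forall delta delta' : theta, delta = delta'.
Proof.
move=> kc H; have kinf := circledast_star_infinite H; case: H => d dP.
(* An infinite proper segment would be as large as the countable [kappa], against initiality. *)
have segfin (a : kappa) : finite_set [set b : kappa | (b < a)%O].
  apply: contrapT => /infiniteP seginf; apply: (cardinal_init (a := a)).
  exact: card_le_trans kc seginf.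
pose I (a : kappa) := fset_set [set b : kappa | (b < a)%O].
have IE a b : (b \in I a) = (b < a)%O 
  by rewrite in_fset_set //; apply/idP/idP; rewrite inE.
have II : injective I.
  move=> a b Iab; apply/eqP; case: ltgtP => //; rewrite -IE.
    by rewrite -Iab IE ltxx.
  by rewrite Iab IE ltxx.
have Iinf B delta : infinite_set B -> exists2 a, B a & d (I a) = delta.
  move=> Binf.
  have IBk (i : 'I_2) : I @` B #= [set: kappa].
    apply/card_eqPle; split.
      apply: card_le_trans (card_image_le _ _) (card_leT _).
    apply: (card_le_trans kc); apply/infiniteP.
    by rewrite (eq_finite_set (inj_card_eq (in2W II))).
  have [x [xB _ dx]] := dP 2 (fun=> I @` B) delta isT IBk.
  have [a Ba xa] := xB ord0; have [b Bb xb] := xB ord_max.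
  (* The union of two initial segments is the longer one, so the union, an admissible [z], is itself
     a segment indexed by [B]. *)
  have [c [Bc cE]] : exists c, B c /\ I c = (\bigcup_(i in 'I_2) x i)%fset.
    rewrite big_ord_recl big_ord1 /=.
    rewrite (_ : lift _ _ = ord_max); last exact: val_inj.
    rewrite -xa -xb; have [ab|/ltW ba] := leP a b.
      exists b; split=> //; apply/fsetP => t; rewrite in_fsetU !IE.
      by rewrite orb_idl // => /lt_le_trans; apply.
    exists a; split=> //; apply/fsetP => t; rewrite in_fsetU !IE.
    by rewrite orb_idr // => /lt_le_trans; apply.
  exists c => //; apply: dx; rewrite cE //.
  apply/fsubsetP => t /bigfcupP[i _]; rewrite inE => /andP[_ ti].
  by apply/bigfcupP; exists i; rewrite ?mem_index_enum.
move=> delta delta'; apply: contrapT => dd.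
have [Bfin|/(Iinf _ delta')] := pselect (finite_set [set a | d (I a) = delta]).
  have /(Iinf _ delta)[a /=] : infinite_set (~` [set a | d (I a) = delta]).
    by rewrite -setTD; exact: infinite_setD.
  by [].
by case=> a /= -> /dd.
Qed.

(** * Separating characters with finite supports *)

Local Open Scope ring_scope.

(* [R] is the graph of an injective morphism from a subgroup of [K] to the
   finitely supported families of nonzero algebraic numbers; only coordinates
   [a] with [iota a] already in the subgroup are in use. *)
Record partial_chars (K : zmodType) (I : Type) (iota : I -> K)
    (R : set (K * (I -> algC))) : Prop := PartialChars {
  pcharsB : forall x f y g, R (x, f) -> R (y, g) ->
    R (x - y, fun a => f a / g a);
  pchars_neq0 : forall x f, R (x, f) -> forall a, f a != 0;
  pchars_finite : forall x f, R (x, f) -> finite_set [set a | f a != 1];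
  pchars0 : forall f, R (0, f) -> f = fun=> 1;
  pchars_inj : forall x, R (x, fun=> 1) -> x = 0;
  pchars_fresh : forall x f a, R (x, f) -> f a != 1 ->
    exists g, R (iota a, g) }.

Section PartialChars.
Variables (K : zmodType) (I : Type) (iota : I -> K).
Implicit Types (R : set (K * (I -> algC))) (x y : K) (f g : I -> algC).

Lemma pchars_id R x f : partial_chars iota R -> R (x, f) -> R (0, fun=> 1).
Proof.
move=> PR Rxf; have := pcharsB PR Rxf Rxf; rewrite subrr.
by congr (R (_, _)); apply/funext => a; rewrite divff ?(pchars_neq0 PR Rxf).
Qed.

Lemma pcharsN R x f : partial_chars iota R -> R (x, f) ->
  R (- x, fun a => (f a)^-1).
Proof.
move=> PR Rxf; have := pcharsB PR (pchars_id PR Rxf) Rxf.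
by rewrite sub0r; congr (R (_, _)); apply/funext => a; rewrite div1r.
Qed.

Lemma pcharsD R x f y g : partial_chars iota R -> R (x, f) -> R (y, g) ->
  R (x + y, fun a => f a * g a).
Proof.
move=> PR Rxf Ryg; have := pcharsB PR Rxf (pcharsN PR Ryg).
by rewrite opprK; congr (R (_, _)); apply/funext => a; rewrite invrK.
Qed.

Lemma pchars_functional R x f g : partial_chars iota R ->
  R (x, f) -> R (x, g) -> f = g.
Proof.
move=> PR Rxf Rxg; have := pcharsB PR Rxf Rxg; rewrite subrr.
move=> /(pchars0 PR) /funeqP fg; apply/funext => a; have /= /eqP := fg a.
by rewrite -subr_eq0 -(divff (pchars_neq0 PR Rxg a)) -mulrBl mulf_eq0
  invr_eq0 (negPf (pchars_neq0 PR Rxg a)) orbF subr_eq0 => /eqP.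
Qed.

Lemma pchars_injective R x y f : partial_chars iota R ->
  R (x, f) -> R (y, f) -> x = y.
Proof.
move=> PR Rxf Ryf; apply/eqP; rewrite -subr_eq0; apply/eqP/(pchars_inj PR).
have := pcharsB PR Rxf Ryf.
by congr (R (_, _)); apply/funext => a; rewrite divff ?(pchars_neq0 PR Rxf).
Qed.

Lemma pcharsMz R x f (k : int) : partial_chars iota R -> R (x, f) ->
  R (x *~ k, fun a => f a ^ k).
Proof.
move=> PR Rxf.
have Mn n : R (x *+ n, fun a => f a ^+ n).
  elim: n => [|n IHn]; first exact: pchars_id PR Rxf.
  have := pcharsD PR Rxf IHn; rewrite -mulrS.
  by congr (R (_, _)); apply/funext => a; rewrite exprS.
case: k => n; first exact: Mn.
by rewrite NegzE mulrNz; exact: pcharsN PR (Mn n.+1).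
Qed.

Lemma pchars_set1 : partial_chars iota [set (0, fun=> 1)].
Proof.
split=> [x f y g||||x|x f a]; last 1 first.
- by case=> _ ->; rewrite eqxx.
- move=> [-> ->] [-> ->] /=; rewrite subr0; congr (_, _).
  by apply/funext => a; rewrite divr1.
- by move=> x f [_ ->] a; rewrite oner_neq0.
- move=> x f [_ ->]; rewrite (_ : mkset _ = set0) //.
  by apply/seteqP; split=> a //=; rewrite eqxx.
- by move=> f [].
- by case.
Qed.

Lemma pchars_bigcup (F : set (set (K * (I -> algC)))) :
  F `<=` partial_chars iota -> total_on F subset ->
  partial_chars iota (\bigcup_(R in F) R).
Proof.
move=> FP Ft; split.
- move=> x f y g [R FR Rxf] [S FS Syg].
  have [RS|SR] := Ft _ _ FR FS.
    by exists S => //; apply: (pcharsB (FP _ FS)) => //; exact: RS.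
  by exists R => //; apply: (pcharsB (FP _ FR)) => //; exact: SR.
- by move=> x f [R FR]; exact: pchars_neq0 (FP _ FR) _ _.
- by move=> x f [R FR]; exact: pchars_finite (FP _ FR) _ _.
- by move=> f [R FR]; exact: pchars0 (FP _ FR) _.
- by move=> x [R FR]; exact: pchars_inj (FP _ FR) _.
- move=> x f a [R FR Rxf] fa; have [g Rg] := pchars_fresh (FP _ FR) Rxf fa.
  by exists g, R.
Qed.

(* The value at the fresh coordinate [i] is a root of unity of the order of
   [iota i] modulo the domain of [R], or 2 when this order is infinite; the
   other coordinates are roots of those already chosen, with 1 taken as the
   root of 1 so that the support stays finite. *)
Lemma pchars_root R (i : I) : partial_chars iota R ->
  R (0, fun=> 1) -> ~ (exists f, R (iota i, f)) ->
  exists y : I -> algC,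
    [/\ forall a, y a != 0,
        finite_set [set a | y a != 1],
        forall a, y a != 1 -> a <> i -> exists g, R (iota a, g),
        forall k f, R (iota i *~ k, f) -> f = fun a => y a ^ k
      & forall k, y i ^ k = 1 -> exists f, R (iota i *~ k, f)].
Proof.
move=> PR R0 Ni.
have fi x f : R (x, f) -> f i = 1.
  move=> Rxf; apply/eqP/negPn/negP => /(pchars_fresh PR Rxf); exact: Ni.
pose D n := `[< (0 < n)%N /\ exists f, R (iota i *+ n, f) >].
have Dabs k f : k != 0 -> R (iota i *~ k, f) -> D `|k|%N.
  move=> k0 Rk; apply/asboolP; rewrite absz_gt0; split=> //.
  have [k_ge0|k_lt0] := leP 0 k.
    by exists f; rewrite pmulrn gez0_abs.
  have := pcharsN PR Rk; rewrite -mulrNz => RN.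
  by exists (fun a => (f a)^-1); rewrite pmulrn ltz0_abs.
have [[n0 Dn0]|noD] := pselect (exists n, D n); last first.
  pose y a : algC := if `[< a = i >] then 2 else 1.
  have yi : y i = 2 by rewrite /y; case: asboolP.
  have y1 a : y a != 1 -> a = i.
    by rewrite /y; case: asboolP => // _; rewrite eqxx.
  exists y; split.
  - by move=> a; rewrite /y; case: ifP => _; rewrite ?oner_neq0 ?pnatr_eq0.
  - apply: sub_finite_set (finite_set1 i) => a; exact: y1.
  - by move=> a /y1.
  - move=> k f Rk; have [k0|k0] := eqVneq k 0; last first.
      by case: noD; exists `|k|%N; exact: Dabs Rk.
    by move: Rk; rewrite k0 mulr0z => /(pchars0 PR) ->.
  - move=> k; rewrite yi => yk; exists (fun=> 1).
    suff -> : k = 0 by rewrite mulr0z.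
    have two n : (2 : algC) ^+ n.+1 <> 1.
      rewrite -natrX => /eqP; rewrite pnatr_eq1 => /eqP/(congr1 odd).
      by rewrite oddX.
    case: k yk => [[|n]|n] //; first by move/two.
    rewrite NegzE => /(congr1 GRing.inv); rewrite invr1 invr_expz opprK.
    by move/two.
have [n Dn nmin] := ex_minnP (ex_intro _ n0 Dn0).
have /asboolP[n_gt0 [u Ru]] := Dn.
have [z zP] := C_prim_root_exists n_gt0.
pose y a : algC := if `[< a = i >] then z else
  if u a == 1 then 1 else n.-root (u a).
have yi : y i = z by rewrite /y; case: asboolP.
have ynE a : a <> i -> u a = 1 -> y a = 1.
  by rewrite /y; case: asboolP => // _ _ ->; rewrite eqxx.
have yn a : y a ^+ n = u a.
  rewrite /y; case: asboolP => [->|_].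
    by rewrite (prim_expr_order zP) (fi _ _ Ru).
  by case: eqP => [->|_]; rewrite ?expr1n // rootCK.
have y0 a : y a != 0.
  by have := pchars_neq0 PR Ru a; rewrite -yn expf_eq0 n_gt0.
have y1 a : y a != 1 -> a <> i -> u a != 1.
  by move=> ya /ynE ai; apply: contra ya => /eqP /ai ->.
(* Subtracting a multiple of [n] puts the remainder of [k] among the exponents in the domain, so it
   vanishes by minimality of [n]. *)
have dvd k f : R (iota i *~ k, f) -> (n %| k)%Z.
  move=> Rk; have := pcharsMz (k %/ n)%Z PR Ru.
  rewrite pmulrn -mulrzA => /(pcharsB PR Rk); rewrite -mulrzBr.
  rewrite [n%:Z * _]mulrC {1}(divz_eq k n) addrAC subrr add0r => Rr.
  apply/dvdz_mod0P/eqP/negP => /negP r0; have := nmin _ (Dabs _ _ r0 Rr).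
  have n0' : n%:Z != 0 by rewrite -lt0n.
  by rewrite leqNgt -ltz_nat gez0_abs ?modz_ge0 ?ltz_pmod.
exists y; split=> //.
- apply: (@sub_finite_set _ _ ([set a | u a != 1] `|` [set i])).
    by move=> a /= ya; have [->|ai] := pselect (a = i); [right|left; exact: y1].
  rewrite finite_setU; split; first exact (pchars_finite PR Ru).
  exact: finite_set1.
- by move=> a ya ai; exact (pchars_fresh PR Ru (y1 _ ya ai)).
- move=> k f Rk; have /dvdzP[q kq] := dvd _ _ Rk.
  have := pcharsMz q PR Ru; rewrite pmulrn -mulrzA mulrC -kq.
  move=> /(pchars_functional PR Rk) ->; apply/funext => a.
  by rewrite -yn kq [q * _]mulrC -exprz_exp.
- move=> k; rewrite yi => zk.
  have /dvdzP[q ->] : (n %| k)%Z.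
    rewrite dvdzE /= (prim_order_dvd zP).
    case: k zk => m zm; apply/eqP; first exact: zm.
    move: zm; rewrite NegzE => /(congr1 GRing.inv).
    by rewrite invr1 invr_expz opprK.
  by exists (fun a => u a ^ q); rewrite mulrC mulrzA -pmulrn; exact: pcharsMz.
Qed.

Lemma pchars_extend R (i : I) : partial_chars iota R ->
  R (0, fun=> 1) -> ~ (exists f, R (iota i, f)) ->
  exists S, [/\ partial_chars iota S, R `<=` S & exists f, S (iota i, f)].
Proof.
move=> PR R0 Ni.
have [y [y0 yfin yfresh yR yi]] := pchars_root PR R0 Ni.
have fi x f : R (x, f) -> f i = 1.
  move=> Rxf; apply/eqP/negPn/negP => /(pchars_fresh PR Rxf); exact: Ni.
(* This is the subgroup generated by [R] and [(iota i, y)]. *)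
pose S : set (K * (I -> algC)) := [set p | exists (h : K) u (k : int),
  R (h, u) /\ p = (h + iota i *~ k, fun a => u a * y a ^ k)].
have RS : R `<=` S.
  move=> [x f] Rxf; exists x, f, 0; split=> //; rewrite mulr0z addr0.
  by congr (_, _); apply/funext => a; rewrite mulr1.
have Si : S (iota i, y).
  exists 0, (fun=> 1), 1; split=> //; rewrite add0r mulr1z.
  by congr (_, _); apply/funext => a; rewrite mul1r expr1z.
exists S; split=> //; last by exists y.
split.
- move=> x f x' f' [h [u [k [Rhu [-> ->]]]]] [h' [u' [k' [Rhu' [-> ->]]]]].
  exists (h - h'), (fun a => u a / u' a), (k - k').
  split; first exact (pcharsB PR Rhu Rhu').
  rewrite mulrzBr opprD addrACA; congr (_, _); apply/funext => a.
  by rewrite expfzDr // -invr_expz invfM mulrACA.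
- move=> x f [h [u [k [Rhu [_ ->]]]]] a.
  by rewrite mulf_neq0 ?(pchars_neq0 PR Rhu) ?expfz_neq0.
- move=> x f [h [u [k [Rhu [_ ->]]]]].
  apply: (@sub_finite_set _ _ ([set a | u a != 1] `|` [set a | y a != 1])).
    move=> a /=; have [->|] := eqVneq (u a) 1; last by left.
    by have [->|] := eqVneq (y a) 1; [rewrite exp1rz mul1r eqxx|right].
  by rewrite finite_setU; split; [exact (pchars_finite PR Rhu)|exact: yfin].
(* Consistency: if h + k iota i = 0, then k iota i = -h is in the old domain, where y ^ k agrees
   with the prescribed value 1 / u. *)
- move=> f [h [u [k [Rhu [/eqP]]]]].
  rewrite eq_sym addrC addr_eq0 => /eqP kh ->.
  have := pcharsN PR Rhu; rewrite -kh => /yR uy.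
  apply/funext => a; have /funeqP/(_ a) /= <- := uy.
  by rewrite divff ?(pchars_neq0 PR Rhu).
(* Injectivity: [u] is 1 at coordinate [i], hence y i ^ k = 1, so k iota i is in the old domain and
   the injectivity of [R] applies. *)
- move=> x [h [u [k [Rhu [-> uy]]]]].
  have [g Rk] : exists g, R (iota i *~ k, g).
    by apply: yi; have /funeqP/(_ i) /= := uy; rewrite (fi _ _ Rhu) mul1r.
  have := pcharsD PR Rhu Rk; rewrite (yR _ _ Rk) -uy => R1.
  exact (pchars_inj PR R1).
- move=> x f a [h [u [k [Rhu [_ ->]]]]] uy.
  have [->|ai] := pselect (a = i); first by exists y.
  suff [g Rg] : exists g, R (iota a, g) by exists g; exact: RS.
  have [u1|u1] := eqVneq (u a) 1; last exact (pchars_fresh PR Rhu u1).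
  apply: yfresh ai; apply: contra uy => /eqP ->.
  by rewrite exp1rz u1 mulr1.
Qed.

End PartialChars.

Lemma exists_chars (K : zmodType) (I : Type) (iota : I -> K) :
  exists2 R : set (K * (I -> algC)), partial_chars iota R &
    forall i, exists f, R (iota i, f).
Proof.
have [R [PR Rmax]] := Zorn_bigcup (@pchars_bigcup K I iota).
exists R => // i; apply: contrapT => Ni.
(* The empty relation also satisfies every clause of [partial_chars]; maximality excludes it. *)
have R0 : R (0, fun=> 1).
  have [[[x f] Rxf]|Re] := pselect (R !=set0); first exact: pchars_id PR Rxf.
  exfalso; apply: Rmax (pchars_set1 iota); split.
    by move=> p Rp; case: Re; exists p.
  by move=> /(_ (0, fun=> 1) erefl) ?; apply: Re; exists (0, fun=> 1).
have [S [PS RS [f Sf]]] := pchars_extend PR R0 Ni.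
by apply: (Rmax S) => //; split=> // SR; apply: Ni; exists f; exact: SR.
Qed.

(** * The group of differences of a cancellative semigroup *)

Section GrothendieckGroup.
Local Open Scope quotient_scope.
Variables (G : addSemigroupType) (g0 : G) (Gcancel : cancellative G).

Definition diff_rel (p q : G * G) := p.1 + q.2 == q.1 + p.2.

Lemma diff_rel_equiv : equiv_class_of diff_rel.
Proof.
split=> [p|p q|q p r]; rewrite /diff_rel; first exact: eqxx.
  by rewrite eq_sym.
(* Transitivity is where cancellation enters: both sides agree after adding [q.2]. *)
move=> /eqP pq /eqP qr; apply/eqP/(Gcancel (a := q.2)).
rewrite Algebra.addrA [q.2 + p.1]Algebra.addrC pq.
by rewrite Algebra.addrAC qr -Algebra.addrA Algebra.addrCA.
Qed.

Canonical diff_equiv := EquivRelPack diff_rel_equiv.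

(* The zero of the group is the class of [(g0, g0)], so its type must mention
   [g0] for the group structure on it to be inferable. *)
Definition grothendieck_type of G := {eq_quot diff_equiv}.
Local Notation grothendieck := (grothendieck_type g0).

HB.instance Definition _ := Choice.on grothendieck.
HB.instance Definition _ := EqQuotient.on grothendieck.

Definition diff (p : G * G) : grothendieck := \pi_(grothendieck) p.

Lemma diffW (P : grothendieck -> Prop) :
  (forall p, P (diff p)) -> forall u, P u.
Proof. by move=> Pdiff u; rewrite -[u]reprK; exact: Pdiff. Qed.

Lemma diffP (p q : G * G) : diff p = diff q <-> p.1 + q.2 = q.1 + p.2.
Proof. by split=> [/eqmodP/eqP|/eqP ?]; [|apply/eqmodP]. Qed.

Definition gadd (u v : grothendieck) := diff (repr u + repr v).
Definition gopp (u : grothendieck) := diff ((repr u).2, (repr u).1).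
Definition gzero := diff (g0, g0).

Lemma repr_diff p : p.1 + (repr (diff p)).2 = (repr (diff p)).1 + p.2.
Proof. by apply/diffP; rewrite /diff reprK. Qed.

Lemma gaddE p q : gadd (diff p) (diff q) = diff (p + q).
Proof.
apply/diffP => /=; rewrite Algebra.addrACA [RHS]Algebra.addrACA.
by rewrite -(repr_diff p) -(repr_diff q).
Qed.

Lemma goppE p : gopp (diff p) = diff (p.2, p.1).
Proof. by apply/diffP => /=; rewrite Algebra.addrC repr_diff Algebra.addrC. Qed.

Fact gaddA : associative gadd.
Proof.
elim/diffW=> p; elim/diffW=> q; elim/diffW=> r.
by rewrite !gaddE Algebra.addrA.
Qed.

Fact gaddC : commutative gadd.
Proof. by move=> u v; rewrite /gadd Algebra.addrC. Qed.

Fact gadd0 : left_id gzero gadd.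
Proof.
elim/diffW=> p; rewrite gaddE; apply/diffP => /=.
by rewrite [g0 + p.1]Algebra.addrC Algebra.addrA.
Qed.

Fact gaddN : left_inverse gzero gopp gadd.
Proof.
elim/diffW=> p; rewrite goppE gaddE; apply/diffP => /=.
by rewrite Algebra.addrC [p.2 + _]Algebra.addrC.
Qed.

HB.instance Definition _ :=
  GRing.isZmodule.Build grothendieck gaddA gaddC gadd0 gaddN.

(** For want of a neutral element, [x] is written as the difference of [x + g0] and [g0]. *)
Definition gincl (x : G) : grothendieck := diff (x + g0, g0).

Lemma ginclD x y : gincl (x + y) = gincl x + gincl y.
Proof.
rewrite /gincl [RHS]gaddE; apply/diffP => /=.
rewrite -!Algebra.addrA; congr (x + _).
by rewrite Algebra.addrCA !Algebra.addrA.
Qed.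

Lemma gincl_inj : injective gincl.
Proof.
move=> x y /diffP /=; rewrite -!Algebra.addrA ![_ + (g0 + g0)]Algebra.addrC.
exact: Gcancel.
Qed.

End GrothendieckGroup.

(** * Coordinates on the semigroup and supports of sums *)

Lemma exists_coordinates (G : addSemigroupType) : cancellative G ->
  exists phi : G -> G -> algC,
    [/\ forall x y a, phi (x + y) a = (phi x a * phi y a),
        forall x, finite_set [set a | phi x a != 1] & injective phi].
Proof.
move=> Gcancel; have [[g0 _]|Ge] := pselect ([set: G] !=set0); last first.
  exists (fun _ _ => 1); split=> [x|x|x]; case: Ge; exists x => //.
have [R PR /choice[phi Rphi]] := exists_chars (gincl g0 Gcancel).
exists phi; split=> [x y a|x|x y phixy].
- have RD := pcharsD PR (Rphi x) (Rphi y); rewrite -ginclD in RD.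
  by rewrite (pchars_functional PR (Rphi _) RD).
- exact (pchars_finite PR (Rphi x)).
- have Ry := Rphi y; rewrite -phixy in Ry.
  exact (gincl_inj (pchars_injective PR (Rphi x) Ry)).
Qed.

Lemma morph_sgsum (G : addSemigroupType) (f : G -> algC) (m : nat)
    (x : 'I_m.+1 -> G) :
  {morph f : x y / (x + y) >-> (x * y)} ->
  f (sgsum x) = (\prod_i f (x i)).
Proof.
move=> fD; rewrite /sgsum big_ord_recl.
have fold y s : f (foldl +%R y s) = (f y * \prod_(z <- s) f z).
  elim: s y => [|z s IHs] y /=; first by rewrite big_nil mulr1.
  by rewrite IHs fD big_cons mulrA.
by rewrite fold big_map big_enum.
Qed.

(** At a point of exactly one support the product of coordinates has a single factor other than 1;
    at a point of none, all factors are 1. *)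
Lemma exists_support (G : addSemigroupType) (T : choiceType) (t0 : T) :
  cancellative G -> [set: G] #<= [set: T] ->
  exists (supp : G -> {fset T}) (code : G -> nat),
    injective (fun x => (supp x, code x)) /\
    forall m (x : 'I_m.+1 -> G),
      ((\bigcup_(i in 'I_m.+1) (supp (x i) `\` \bigcup_(j | j != i) supp (x j)))
        `<=` supp (sgsum x))%fset /\
      (supp (sgsum x) `<=` \bigcup_(i in 'I_m.+1) supp (x i))%fset.
Proof.
move=> Gcancel /(inj_card_leP _ _ t0)[e _ eI'].
have eI : injective e by move=> x y; apply: eI'; rewrite inE.
have [phi [phiD phi_fin phiI]] := exists_coordinates Gcancel.
pose S x := fset_set [set a | phi x a != 1].
have SE x a : (a \in S x) = (phi x a != 1).
  by rewrite in_fset_set //; apply/idP/idP; rewrite inE.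
pose supp x := (e @` S x)%fset.
have suppE x a : (e a \in supp x) = (phi x a != 1) by rewrite mem_imfset //= SE.
have phi_sum m (x : 'I_m.+1 -> G) a : phi (sgsum x) a = (\prod_i phi (x i) a).
  exact: (morph_sgsum (f := phi^~ a)).
(* The code lists the coordinates on the support, algebraic numbers being countable; with the
   support it determines all of [phi x]. *)
exists supp, (fun x => choice.pickle (map (phi x) (enum_fset (S x)))); split.
  move=> x y [sxy /(pcan_inj choice.pickleK)].
  have Sxy : S x = S y by apply/fsetP => a; rewrite !SE -!suppE sxy.
  rewrite -Sxy => /eq_in_map phixy; apply: phiI; apply/funext => a.
  have [/phixy//|aS] := boolP (a \in S x).
  have := aS; rewrite {1}Sxy; move: aS.
  by rewrite !SE !negbK => /eqP -> /eqP ->.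
move=> m x; split; apply/fsubsetP => t.
  move=> /bigfcupP[i _]; rewrite inE => /andP[tNj /imfsetP[a /= aS tE]].
  rewrite tE suppE phi_sum (bigD1 i) //= big1 ?mulr1 -?SE // => j ji.
  apply/eqP; rewrite -[_ == _]negbK -suppE -tE; apply: contra tNj => tj.
  by apply/bigfcupP; exists j => //; rewrite mem_index_enum.
move=> tS; have /imfsetP[a /= _ tE] := tS; move: tS; rewrite tE suppE phi_sum.
move=> prod1; apply/bigfcupP; apply: contrapT => Nex.
case/eqP: prod1; apply: big1 => i _; apply/eqP; rewrite -[_ == _]negbK -suppE.
by apply/negP => ai; apply: Nex; exists i; rewrite ?mem_index_enum.
Qed.

(** * The colouring, for uncountable and countable cardinals *)

Lemma SuS_negative_uncountable (G : addSemigroupType) (kappa theta : cardinal) :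
  cancellative G -> [set: G] #<= [set: kappa] -> ~ countable [set: kappa] ->
  circledast_star kappa theta -> SuS_negative G kappa theta.
Proof.
move=> Gcancel Gk kunc [d dP].
have [k0 _] : [set: kappa] !=set0.
  by apply/set0P/negP => /eqP k0; apply: kunc; rewrite k0.
have [supp [code [suppI supp_sum]]] := exists_support k0 Gcancel Gk.
exists (fun x => d (supp x)) => m X Xk; apply/seteqP; split=> // delta _.
have Yk i : supp @` X i #= [set: kappa].
  exact: card_image_countable_fibres suppI kunc (Xk i).
have [y [Xy _ dy]] := dP _ (fun i => supp @` X i) delta isT Yk.
have /choice[x xP] : forall i, exists x, X i x /\ supp x = y i.
  by move=> i; have [x Xx xy] := Xy i; exists x.
exists (sgsum x); first by exists x => // i; exact: (xP i).1.
have yE : y = fun i => supp (x i) by apply/funext => i; rewrite (xP i).2.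
by have [lo hi] := supp_sum _ x; apply: dy; rewrite yE.
Qed.

Theorem theorem4p2 (G : addSemigroupType) (kappa theta : cardinal) :
  cancellative G ->
  ([set: G] #= [set: kappa])%classic%card ->
  ([set: theta] #<= [set: kappa])%classic%card ->
  circledast_star kappa theta ->
  SuS_negative G kappa theta.
Proof.
move=> Gcancel Gk _ H.
have [kc|kunc] := pselect (countable [set: kappa]); last first.
  by apply: SuS_negative_uncountable => //; by have /card_eqPle[] := Gk.
have kinf := circledast_star_infinite H.
have theta1 := circledast_star_countable kc H; have [d _] := H.
(* As [theta] has one element, the constant colouring works once the sumset is nonempty, which holds
   because each [X i] is infinite. *)
exists (fun=> d fset0) => m X Xk; apply/seteqP; split=> // delta _.
have /choice[x Xx] : forall i, exists x, X i x.
  by move=> i; apply: infinite_setN0; rewrite (eq_finite_set (Xk i)).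
by exists (sgsum x); [exists x|exact: theta1].
Qed.
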